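(* Let $\phi$ be an unsatisfiable linear $r$-CNF formula. Then $\mathrm{Space}(\phi)\ge \mathrm{Width}(\phi)-r-1$.
   Context: Linear clauses are disjunctions of linear literals $f=\alpha$ ($f$ a linear form over $\mathbb{F}_2$, $\alpha\in\{0,1\}$); the width of a linear clause is its number of linear literals; a linear $r$-CNF is a conjunction of linear clauses each of width at most $r$. $\mathrm{Res}(\oplus)$ rules: from $A\lor(f=0)$ and $B\lor(f=1)$ derive $A\lor B$; from $C$ derive any linear clause semantically implied by $C$. $\mathrm{Width}(\phi)$ is the minimum, over $\mathrm{Res}(\oplus)$ refutations (derivations of the empty clause from the clauses of $\phi$), of the maximum width of a clause in the refutation. For space, a refutation is a sequence of configurations (sets of linear clauses) $S_1=\emptyset,\dots,S_m$ with $S_m$ containing the empty clause, each obtained from the previous by download (add a clause of $\phi$), erasure (remove a clause), or inference (add a clause derived by the rules from the current clauses); its space is $\max_i|S_i|$, and $\mathrm{Space}(\phi)$ is the minimum space of a refutation of $\phi$. *)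

(* Defs.v *)
From mathcomp Require Import all_boot all_order all_algebra.
From mathcomp Require Import boolp.

Set Implicit Arguments.
Unset Strict Implicit.
Unset Printing Implicit Defensive.

Import GRing.Theory.
Local Open Scope ring_scope.

(* The row vector [f] encodes the linear form sum_i f_i x_i; the pair [(f, a)]
   is the linear literal "f = a". *)
Notation literal n := ('rV['F_2]_n * 'F_2)%type.

(* Disjunction of its members; its width is its cardinality. *)
Notation clause n := {set literal n}.

(* Conjunction of its members. *)
Notation cnf n := {set clause n}.

Notation configuration n := {set clause n}.

Definition empty_clause n : clause n := set0.

Section LinearClauses.
Variable n : nat.
Implicit Types (x f : 'rV['F_2]_n) (l : literal n) (C D : clause n)
  (phi : cnf n) (S : configuration n).

Definition eval_form f x : 'F_2 := \sum_(i < n) f 0 i * x 0 i.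

Definition sat_literal l x : bool := eval_form l.1 x == l.2.

Definition sat_clause C x : bool := [exists l in C, sat_literal l x].

Definition sat_cnf phi x : bool := [forall C in phi, sat_clause C x].

Definition unsatisfiable phi : bool := ~~ [exists x, sat_cnf phi x].

Definition linear_cnf (r : nat) phi : bool := [forall C in phi, #|C| <= r]%N.

Definition implies_clause C D : bool :=
  [forall x, sat_clause C x ==> sat_clause D x].

(* [infers S C]: [C] follows from clauses of [S] by one application of a
   rule of Res(+). *)
Inductive infers S : clause n -> Prop :=
| infers_resolution (A B : clause n) f of
    (f, 0) |: A \in S & (f, 1) |: B \in S : infers S (A :|: B)
| infers_weakening C D of C \in S & implies_clause C D : infers S D.

Definition derivation phi (pi : seq (clause n)) : Prop :=
  forall i, (i < size pi)%N ->
    let C := nth (empty_clause n) pi i in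
    C \in phi \/ infers [set D in take i pi] C.

Definition refutation phi (pi : seq (clause n)) : Prop :=
  derivation phi pi /\ empty_clause n \in pi.

Definition refutation_width (pi : seq (clause n)) : nat :=
  (\max_(C <- pi) #|C|)%N.

Inductive step phi S : configuration n -> Prop :=
| step_download C of C \in phi : step phi S (C |: S)
| step_erasure C of C \in S : step phi S (S :\ C)
| step_inference C of infers S C : step phi S (C |: S).

Definition space_refutation phi (Ss : seq (configuration n)) : Prop :=
  [/\ (0 < size Ss)%N,
      nth set0 Ss 0%N = set0,
      forall i, (i.+1 < size Ss)%N -> step phi (nth set0 Ss i) (nth set0 Ss i.+1)
    & empty_clause n \in last set0 Ss].

Definition refutation_space (Ss : seq (configuration n)) : nat :=
  (\max_(S <- Ss) #|S|)%N.

(* Completeness of Res(+), which makes the minima below well defined: derive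
   the clauses falsified exactly when the first [k] variables agree with [x],
   for [k] from [n] down to 0. *)
Let prefix_clause (k : nat) x : clause n :=
  [set (delta_mx 0 i, x 0 i + 1) | i : 'I_n & (i < k)%N].

Lemma derivation_rcons phi pi C :
  derivation phi pi -> C \in phi \/ infers [set D in pi] C ->
  derivation phi (rcons pi C).
Proof.
move=> dpi hC i; rewrite size_rcons ltnS leq_eqVlt => /orP[/eqP->|lti].
  by rewrite /= nth_rcons ltnn eqxx -cats1 take_size_cat.
by rewrite /= nth_rcons lti -cats1 takel_cat ?(ltnW lti) //; apply: dpi.
Qed.

Let eval_delta i x : eval_form (delta_mx 0 i) x = x 0 i.
Proof.
rewrite /eval_form (bigD1 i) //= !mxE !eqxx mul1r big1 ?addr0 // => j ji.
by rewrite !mxE (negPf ji) andbF mul0r.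
Qed.

Let F2P (a b : 'F_2) : a != b -> a = b + 1.
Proof. by case: a b => [[|[|//]] ?] [[|[|//]] ?] // _; apply: val_inj. Qed.

Let prefix_derivation phi : unsatisfiable phi ->
  forall m k x pi, (k + m = n)%N -> derivation phi pi ->
  exists2 pi', derivation phi (pi ++ pi') & prefix_clause k x \in pi'.
Proof.
rewrite /unsatisfiable negb_exists => /forallP unsat.
elim=> [|m IH] k x pi km dpi.
  have := unsat x; rewrite negb_forall => /existsP[C].
  rewrite negb_imply => /andP[Cphi Cx].
  exists [:: C; prefix_clause k x]; last by rewrite !inE eqxx orbT.
  rewrite -[_ ++ _]/(pi ++ [:: C] ++ [:: prefix_clause k x]) catA !cats1.
  apply: derivation_rcons; first by apply: derivation_rcons => //; left.
  right; apply: (@infers_weakening _ C); first by rewrite inE mem_rcons inE eqxx.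
  apply/forallP => y; apply/implyP => Cy.
  have /existsP[i yi] : [exists i, y 0 i != x 0 i].
    apply: contraNT Cx; rewrite negb_exists => /forallP e.
    suff -> : x = y by [].
    by apply/rowP => i; have := e i; rewrite negbK => /eqP.
  apply/existsP; exists (delta_mx 0 i, x 0 i + 1); apply/andP; split.
    by apply/imsetP; exists i => //; rewrite inE (_ : k = n) // -km addn0.
  by rewrite /sat_literal /= eval_delta; apply/eqP/F2P.
have kn : (k < n)%N by rewrite -km addnS ltnS leq_addr.
pose k0 := Ordinal kn.
pose y a : 'rV['F_2]_n := \row_i (if i == k0 then a else x 0 i).
have km' : (k.+1 + m = n)%N by rewrite addSnnS.
have ey a : prefix_clause k.+1 (y a) = (delta_mx 0 k0, a + 1) |: prefix_clause k x.
  apply/setP => l; rewrite in_setU1; apply/imsetP/orP.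
    case=> i; rewrite inE ltnS leq_eqVlt => /orP[/eqP ik|ik] ->.
      have -> : i = k0 by apply: val_inj.
      by left; rewrite mxE eqxx.
    right; apply/imsetP; exists i; first by rewrite inE.
    by rewrite mxE -val_eqE /= (ltn_eqF ik).
  case=> [/eqP->|/imsetP[i]].
    by exists k0; rewrite ?inE //= mxE eqxx.
  rewrite inE => ik ->; exists i; first by rewrite inE ltnS ltnW.
  by rewrite mxE -val_eqE /= (ltn_eqF ik).
have [p1 d1 m1] := IH _ (y 1) _ km' dpi.
have [p2 d2 m2] := IH _ (y 0) _ km' d1.
exists (rcons (p1 ++ p2) (prefix_clause k x)); last by rewrite mem_rcons inE eqxx.
rewrite -rcons_cat catA; apply: derivation_rcons => //; right.
rewrite -[prefix_clause k x]setUid; apply: (@infers_resolution _ _ _ (delta_mx 0 k0)).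
  have <- : 1 + 1 = 0 :> 'F_2 by apply: val_inj.
  by rewrite -ey inE !mem_cat m1 orbT.
have {1}<- : 0 + 1 = 1 :> 'F_2 by apply: val_inj.
by rewrite -ey inE !mem_cat m2 orbT.
Qed.

Lemma refutation_exists phi : unsatisfiable phi -> exists pi, refutation phi pi.
Proof.
move=> unsat.
have [//|pi dpi e] := @prefix_derivation phi unsat n 0%N 0 [::] (add0n n).
exists pi; split=> //.
suff <- : prefix_clause 0 0 = empty_clause n by [].
by apply/setP => l; rewrite inE; apply/imsetP => -[i]; rewrite inE.
Qed.

Lemma space_refutation_exists phi :
  unsatisfiable phi -> exists Ss, space_refutation phi Ss.
Proof.
move=> /refutation_exists[pi [dpi e]].
pose F i : configuration n := [set C in take i pi].
exists (mkseq F (size pi).+1); split.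
- by rewrite size_mkseq.
- by rewrite nth_mkseq //; apply/setP => C; rewrite !inE take0.
- move=> i; rewrite size_mkseq ltnS => ip.
  rewrite !nth_mkseq ?ltnS ?(ltnW ip) //.
  have -> : F i.+1 = nth (empty_clause n) pi i |: F i.
    by apply/setP => C; rewrite !inE (take_nth (empty_clause n) ip) mem_rcons inE.
  by case: (dpi i ip) => ?; [apply: step_download | apply: step_inference].
- by rewrite (last_nth set0) size_mkseq /= -[X in nth _ X]/(mkseq F (size pi).+1)
    nth_mkseq // inE take_size.
Qed.

Lemma width_exists phi : unsatisfiable phi ->
  exists w, `[< exists2 pi, refutation phi pi & refutation_width pi = w >].
Proof.
move=> /refutation_exists[pi Hpi].
by exists (refutation_width pi); apply/asboolP; exists pi.
Qed.

Lemma space_exists phi : unsatisfiable phi ->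
  exists s, `[< exists2 Ss, space_refutation phi Ss & refutation_space Ss = s >].
Proof.
move=> /space_refutation_exists[Ss HSs].
by exists (refutation_space Ss); apply/asboolP; exists Ss.
Qed.

Definition min_width phi (phi_unsat : unsatisfiable phi) : nat :=
  ex_minn (width_exists phi_unsat).

Definition min_space phi (phi_unsat : unsatisfiable phi) : nat :=
  ex_minn (space_exists phi_unsat).

End LinearClauses.

(* Main.v *)
Require Import Defs.
From mathcomp Require Import all_boot all_order all_algebra.
From mathcomp Require Import boolp zify.

(** Read a space refutation backwards. The negation of a configuration [S] is
    equivalent to the conjunction of the clauses that contain, for every clause
    of [S], the negation of one of its literals; such clauses may be taken of
    width at most [#|S|]. If all of them are derivable for a configuration, then
    so are those for its predecessor, by steps that exceed the space by at most
    [r + 1] in width. The last configuration contains the empty clause and so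
    has no such clause; for the initial configuration the empty clause is one. *)

Set Implicit Arguments.
Unset Strict Implicit.
Unset Printing Implicit Defensive.

Import GRing.Theory.
Local Open Scope ring_scope.

(** * Linear literals and linear systems over the two-element field *)

Lemma addF2K (a : 'F_2) : a + a = 0.
Proof. by case: a => -[|[|//]] ?; apply: val_inj. Qed.

Lemma F2_neqE (a b : 'F_2) : (a == b + 1) = (a != b).
Proof. by case: a b => [[|[|//]] ?] [[|[|//]] ?]. Qed.

Lemma F2_neq0 (a : 'F_2) : a != 0 -> a = 1.
Proof. by case: a => -[|[|//]] ? // _; apply: val_inj. Qed.

Section Literals.
Variable n : nat.
Implicit Types (x f : 'rV['F_2]_n) (l : literal n) (C D K : clause n)
  (S T : configuration n).

Definition neg_literal l : literal n := (l.1, l.2 + 1).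

Lemma neg_literalK : involutive neg_literal.
Proof. by case=> f a; rewrite /neg_literal /= -addrA addF2K addr0. Qed.

Lemma sat_neg_literal l x : sat_literal (neg_literal l) x = ~~ sat_literal l x.
Proof. by rewrite /sat_literal /= F2_neqE. Qed.

Lemma eval_formD f g x : eval_form (f + g) x = eval_form f x + eval_form g x.
Proof.
by rewrite /eval_form -big_split; apply: eq_bigr => i _; rewrite mxE mulrDl.
Qed.

Lemma sat_clauseU1 l C x :
  sat_clause (l |: C) x = sat_literal l x || sat_clause C x.
Proof.
apply/existsP/orP => [[k /andP[]]|[lx|/existsP[k /andP[kC kx]]]].
- rewrite in_setU1 => /orP[/eqP->|kC] kx; [by left | right].
  by apply/existsP; exists k; rewrite kC.
- by exists l; rewrite setU11.
- by exists k; rewrite in_setU1 kC orbT.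
Qed.

Lemma card_clauseU1 l C m : (#|C| < m)%N -> (#|l |: C| <= m)%N.
Proof. by move=> Cm; rewrite cardsU1; apply: leq_trans Cm; case: (_ \notin _). Qed.

Lemma implies_clauseS C D : C \subset D -> implies_clause C D.
Proof.
move=> /subsetP CD; apply/forallP => x; apply/implyP => /existsP[l /andP[lC lx]].
by apply/existsP; exists l; rewrite CD.
Qed.

Lemma inferring_sound S C x :
  infers S C -> (forall D, D \in S -> sat_clause D x) -> sat_clause C x.
Proof.
case=> [A B f SA SB|C' D SC' /forallP/(_ x)/implyP C'D] Sx; last exact/C'D/Sx.
have sub (E F : clause n) : E \subset F -> sat_clause E x -> sat_clause F x.
  by move=> /implies_clauseS/forallP/(_ x)/implyP.
have := Sx _ SA; rewrite sat_clauseU1 => /orP[f0|]; last exact/sub/subsetUl.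
have := Sx _ SB; rewrite sat_clauseU1 => /orP[f1|]; last exact/sub/subsetUr.
by move: f0 f1; rewrite /sat_literal /= => /eqP->.
Qed.

Lemma infers_subset S T C : S \subset T -> infers S C -> infers T C.
Proof.
move=> /subsetP ST [A B f /ST fA /ST fB|C' D /ST C'T CD].
  exact: infers_resolution fA fB.
exact: infers_weakening C'T CD.
Qed.

(** Linear algebra: a system over the two-element field is solvable unless [0 = 1] is a sum of its
    equations. Scalars are 0 or 1, so closure under addition suffices. [L] is abstract so that it
    can stand for derivability of a literal joined with a fixed clause. *)
Lemma unsat_linear_combination (L : 'rV['F_2]_n -> 'F_2 -> Prop) (T : {set literal n}) :
    L 0 0 ->
    (forall f g a b, L f a -> L g b -> L (f + g) (a + b)) ->
    (forall l, l \in T -> L l.1 l.2) ->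
    (forall x, ~~ [forall l in T, sat_literal l x]) ->
  L 0 1.
Proof.
move=> L0 LD LT unsatT.
pose M : 'M['F_2]_(#|T|, n + 1) :=
  \matrix_i row_mx (enum_val i).1 (enum_val i).2%:M.
pose P (v : 'rV['F_2]_(n + 1)) := L (lsubmx v) (rsubmx v 0 0).
have P0 : P 0 by rewrite /P !linear0 mxE.
have PD u v : P u -> P v -> P (u + v).
  by move=> Pu Pv; have := LD _ _ _ _ Pu Pv; rewrite /P !linearD !mxE.
have PM i : P (row i M).
  rewrite rowK /P row_mxKl row_mxKr !mxE eqxx mulr1n.
  exact/LT/enum_valP.
have [/submxP[u e]|] := boolP (row_mx (0 : 'rV['F_2]_n) 1%:M <= M)%MS.
  have : P (row_mx 0 1%:M).
    rewrite e mulmx_sum_row; elim/big_ind: _ => // i _.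
    have [->|/F2_neq0->] := eqVneq (u 0 i) 0; first by rewrite scale0r.
    by rewrite scale1r.
  by rewrite /P row_mxKl row_mxKr !mxE eqxx.
(* Now [(0 | 1)] is outside the row space of the augmented matrix [M], so some column of [cokermx M]
   is annihilated by every row of [M] but has last entry 1. Its upper part solves the system. *)
rewrite submxE => /matrix0Pn[i [j]].
have := mulmx_coker M; rewrite -[cokermx M]vsubmxK.
move: (usubmx _) (dsubmx _) => U D MUD.
rewrite mul_row_col mul0mx add0r mul1mx !(ord1 i) => nz.
have {nz} D1 : D 0 j = 1 by apply: F2_neq0.
case/negP: (unsatT (\row_k U k j)).
apply/forallP => l; apply/implyP => lT.
have := congr1 (row (enum_rank_in lT l)) MUD.
rewrite row_mul rowK enum_rankK_in // mul_row_col mul_scalar_mx => /rowP/(_ j).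
rewrite !mxE D1 mulr1 => e; rewrite /sat_literal -subr_eq0 /eval_form.
under eq_bigr do rewrite mxE.
by rewrite (_ : - l.2 = l.2) ?e // -[RHS]addr0 -[in RHS](subrr l.2) addrA addF2K add0r.
Qed.

End Literals.

(** * Derivability within width [w] *)

Section Width.
Variables (n : nat) (phi : cnf n) (w : nat).
Implicit Types (A B C D K : clause n) (S : configuration n) (l : literal n).

(** An inductive predicate lets derivations be combined without list bookkeeping;
    [refutation_of_derivable] turns them back into sequences. *)
Inductive derivable : clause n -> Prop :=
| derivable_axiom C of C \in phi & (#|C| <= w)%N : derivable C
| derivable_inference S C of
    (forall D, D \in S -> derivable D) & infers S C & (#|C| <= w)%N :
    derivable C.

Lemma derivable_weakening C D :
  derivable C -> implies_clause C D -> (#|D| <= w)%N -> derivable D.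
Proof.
move=> dC CD; apply: (@derivable_inference [set C]).
  by move=> E /set1P->.
by apply: infers_weakening CD; rewrite set11.
Qed.

Lemma derivable_subset C D :
  derivable C -> C \subset D -> (#|D| <= w)%N -> derivable D.
Proof. by move=> dC /implies_clauseS; apply: derivable_weakening. Qed.

Lemma derivable_resolution l A B :
    derivable (l |: A) -> derivable (neg_literal l |: B) ->
    (#|A :|: B| <= w)%N ->
  derivable (A :|: B).
Proof.
wlog: l A B / l.2 = 0 => [wlg|].
  have [l0|/F2_neq0 l1 dA dB AB] := eqVneq l.2 0; first exact: wlg.
  rewrite setUC; apply: (wlg (neg_literal l)) => //.
  - by rewrite /= l1 addF2K.
  - by rewrite neg_literalK.
  - by rewrite setUC.
case: l => f _ /= ->; rewrite /neg_literal /= add0r => dA dB.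
apply: (@derivable_inference [set (f, 0) |: A; (f, 1) |: B]).
  by move=> E /set2P[->|->].
by apply: (@infers_resolution _ _ A B f); rewrite !inE eqxx ?orbT.
Qed.

(** The literals of [C] are resolved away one at a time; every intermediate clause lies within
    [C :|: K], which bounds the width. *)
Lemma derivable_resolve_clause C K :
    derivable (C :|: K) -> (#|C| + #|K| <= w)%N ->
    (forall l, l \in C -> derivable (neg_literal l |: K)) ->
  derivable K.
Proof.
move: {2}#|C| (leqnn #|C|) => m; elim: m C => [|m IH] C.
  by rewrite leqn0 cards_eq0 => /eqP->; rewrite set0U.
have [->|[l lC]] := set_0Vmem C; first by rewrite set0U.
rewrite (cardsD1 l) lC ltnS => Cm dCK CKw dneg.
have CDw : (#|C :\ l :|: K| <= w)%N.
  by rewrite (leq_trans (leq_card_setU _ _)) // (leq_trans _ CKw) ?leq_addl.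
apply: (IH (C :\ l)) => //.
(* Doubling [K] gives the goal the shape of a resolvent whose premises both contain [K]. *)
- rewrite -[K in _ :|: K]setUid setUA; apply: (@derivable_resolution l).
  + by rewrite setUA setD1K.
  + exact: dneg.
  + by rewrite -setUA setUid.
- by apply: leq_trans CKw; rewrite leq_add2r leq_addl.
- by move=> k /setD1P[_ /dneg].
Qed.

(* Weaken [(f = a) \/ K] to [(g = b + 1) \/ (f + g = a + b) \/ K] and resolve
   with [(g = b) \/ K]. *)
Lemma derivable_add f g (a b : 'F_2) K :
    (#|K| + 2 <= w)%N ->
    derivable ((f, a) |: K) -> derivable ((g, b) |: K) ->
  derivable ((f + g, a + b) |: K).
Proof.
move=> Kw dfa dgb.
rewrite -[K in derivable (_ |: K)]setUid setUCA.
apply: (@derivable_resolution (g, b)) => //; last first.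
  by rewrite setUCA setUid; apply: card_clauseU1; lia.
apply: (derivable_weakening dfa); last first.
  by apply: card_clauseU1; rewrite (leq_trans _ Kw) // addn2 ltnS card_clauseU1.
apply/forallP => x; apply/implyP; rewrite !sat_clauseU1 sat_neg_literal.
case/orP=> [/eqP /= fa|->]; last by rewrite !orbT.
have [/eqP /= gb|//] := boolP (sat_literal (g, b) x).
by rewrite {1}/sat_literal /= eval_formD fa gb eqxx.
Qed.

(** Where [K] fails [D] holds, so the negated literals of [D :|: K] form an inconsistent system.
    Each equation joined with [K] is derivable, and summing by [derivable_add] gives [0 = 1] joined
    with [K]. The sums need only two literals beyond [K], however wide [D] is. *)
Lemma derivable_by_implication D K :
    phi != set0 -> (forall C, C \in phi -> (#|C| <= w)%N) ->
    (#|K| + 2 <= w)%N ->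
    (forall l, l \in D -> derivable (neg_literal l |: K)) ->
    (forall x, ~~ sat_clause K x -> sat_clause D x) ->
  derivable K.
Proof.
move=> /set0Pn[C0 C0phi] phiw Kw dneg KD.
have cU1 l : (#|l |: K| <= w)%N by apply: card_clauseU1; lia.
(* The weakening rule needs a premise, so tautologies are obtained from an arbitrary clause of
   [phi]. *)
have taut l : (forall x, sat_clause (l |: K) x) -> derivable (l |: K).
  move=> t; apply: (@derivable_weakening C0) => //.
    by apply: derivable_axiom => //; apply: phiw.
  by apply/forallP => x; rewrite t implybT.
suff d01 : derivable ((0, 1) |: K).
  apply: derivable_weakening d01 _ _; last lia.
  apply/forallP => x; apply/implyP; rewrite sat_clauseU1 => /orP[|//].
  by rewrite /sat_literal /eval_form big1 // => i _; rewrite mxE mul0r.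
apply: (@unsat_linear_combination n (fun f a => derivable ((f, a) |: K))
   [set neg_literal l | l in D :|: K]) => [|f g a b||x].
- apply: taut => x; rewrite sat_clauseU1 /sat_literal /eval_form big1 ?eqxx //.
  by move=> i _; rewrite mxE mul0r.
- exact: derivable_add.
- move=> _ /imsetP[l lDK ->]; rewrite -surjective_pairing.
  case/setUP: lDK => [/dneg//|lK]; apply: taut => x.
  rewrite sat_clauseU1 sat_neg_literal -implybE; apply/implyP => lx.
  by apply/existsP; exists l; rewrite lK.
- apply/negP => /forallP sat.
  have unsatDK l : l \in D :|: K -> ~~ sat_literal l x.
    by move=> lDK; rewrite -sat_neg_literal (implyP (sat _)) // imset_f.
  have /KD/existsP[l /andP[lD lx]] : ~~ sat_clause K x.
    rewrite negb_exists; apply/forallP => l; rewrite negb_and -implybE.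
    by apply/implyP => lK; rewrite unsatDK // in_setU lK orbT.
  by have := unsatDK l; rewrite in_setU lD lx => /(_ isT).
Qed.

Lemma refutation_of_derivable :
  derivable set0 -> exists2 pi, refutation phi pi & (refutation_width pi <= w)%N.
Proof.
pose ok pi := derivation phi pi /\ {in pi, forall C, (#|C| <= w)%N}.
have ok_rcons pi C : ok pi -> (#|C| <= w)%N ->
    C \in phi \/ infers [set D in pi] C -> ok (rcons pi C).
  move=> [dpi wpi] Cw hC; split; first exact: derivation_rcons.
  by move=> D; rewrite mem_rcons inE => /orP[/eqP->|/wpi].
(* Quantifying over the sequence [pi] already built allows the premises of an inference to be
   appended in turn. *)
suff ext C : derivable C -> forall pi, ok pi ->
    exists2 pi', ok pi' & {subset C :: pi <= pi'}.
  move=> /ext/(_ [::])[|pi [dpi wpi] spi].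
    by split=> // i; rewrite ltn0.
  exists pi; first by split=> //; apply: spi; rewrite inE eqxx.
  rewrite /refutation_width big_seq; elim/big_ind: _ => // a b aw bw.
  by rewrite geq_max aw.
elim=> {C} [C Cphi Cw|S C _ IH SC Cw] pi okpi.
  exists (rcons pi C); first by apply: ok_rcons => //; left.
  by move=> D; rewrite mem_rcons.
have [pi' okpi' spi'] : exists2 pi', ok pi' & {subset enum S ++ pi <= pi'}.
  have : {subset enum S <= S} by move=> D; rewrite mem_enum.
  elim: (enum S) => [|D s IHs] sS; first by exists pi.
  have [|pi1 ok1 s1] := IHs; first by move=> E Es; rewrite sS // inE Es orbT.
  have [|pi2 ok2 s2] := IH D _ pi1 ok1; first by rewrite sS // inE eqxx.
  exists pi2 => // E; rewrite /= inE => /orP[/eqP->|/s1 E1].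
    by apply: s2; rewrite inE eqxx.
  by apply: s2; rewrite inE E1 orbT.
exists (rcons pi' C).
  apply: ok_rcons => //; right; apply: infers_subset SC.
  by apply/subsetP => D DS; rewrite inE spi' // mem_cat mem_enum DS.
move=> D; rewrite mem_rcons !inE => /orP[->//|Dpi].
by rewrite spi' ?orbT // mem_cat Dpi orbT.
Qed.

End Width.

(** * Backward induction along a space refutation *)

Section Hitting.
Variable n : nat.
Implicit Types (C D K : clause n) (S : configuration n) (l : literal n).

(* The clauses [K] with [hits K S] are those implied by the negation of [S]. *)
Definition hits K S : Prop :=
  forall C, C \in S -> exists2 l, l \in C & neg_literal l \in K.

Lemma small_hits K S :
  hits K S -> exists2 K' : clause n, K' \subset K & (#|K'| <= #|S|)%N /\ hits K' S.
Proof.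
move=> hK.
(* One literal is chosen per clause; the default is never taken on members of [S]. *)
pose h C : literal n := odflt (0, 0) [pick l in C | neg_literal l \in K].
have hP C : C \in S -> h C \in C /\ neg_literal (h C) \in K.
  move=> /hK[l lC lK]; rewrite /h; case: pickP => [k /andP[]//|/(_ l)].
  by rewrite lC lK.
exists [set neg_literal (h C) | C in S].
  by apply/subsetP => _ /imsetP[C /hP[_ hC] ->].
split; first exact: leq_imset_card.
by move=> C CS; exists (h C); [case: (hP _ CS) | apply: imset_f].
Qed.

Lemma hits_setU1 K S C l :
  hits K S -> l \in C -> hits (neg_literal l |: K) (C |: S).
Proof.
move=> hK lC D /setU1P[->|/hK[k kD kK]].
  by exists l; rewrite ?setU11.
by exists k; rewrite // in_setU1 kK orbT.
Qed.

Lemma hits_sat K S x :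
  hits K S -> ~~ sat_clause K x -> forall C, C \in S -> sat_clause C x.
Proof.
move=> hK Kx C /hK[l lC lK]; apply/existsP; exists l; rewrite lC /=.
apply: contraNT Kx; rewrite -sat_neg_literal => lx.
by apply/existsP; exists (neg_literal l); rewrite lK.
Qed.

Variables (phi : cnf n) (r s : nat).
Hypotheses (phi_rcnf : linear_cnf r phi) (phi_neq0 : phi != set0).
Let w := (s + r + 1)%N.

(** After shrinking [K] to [K'], erasure is immediate. If a clause [C] is added, joining [K'] with
    the negation of any literal of [C] hits [S'], so these clauses are derivable. A download then
    resolves them with [C], at width at most [r] beyond [K']; an inference uses that [C] follows
    from the negation of [K'], with two literals beyond [K']. *)
Lemma derivable_hits_step S S' :
    step phi S S' -> (#|S| <= s)%N -> (#|S'| <= s)%N ->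
    (forall K, (#|K| <= w)%N -> hits K S' -> derivable phi w K) ->
  forall K, (#|K| <= w)%N -> hits K S -> derivable phi w K.
Proof.
have phir C : C \in phi -> (#|C| <= r)%N by exact/implyP/(forallP phi_rcnf).
move=> St Ss S's IH K Kw /small_hits[K' K'K [cK' hK']].
apply: derivable_subset K'K Kw.
(* Common to download and inference. If [C] is new, then [S] has fewer than [s] clauses, which
   leaves [K'] room for one more literal. *)
have add C : (C \notin S -> #|C |: S| <= s)%N ->
    (forall K, (#|K| <= w)%N -> hits K (C |: S) -> derivable phi w K) ->
    ((#|K'| < s)%N -> (forall l, l \in C -> derivable phi w (neg_literal l |: K')) ->
      derivable phi w K') -> derivable phi w K'.
  move=> CSs IHC; have [CS _|CS ok] := boolP (C \in S).
    by apply: IHC; [rewrite /w; lia | rewrite (setUidPr _) ?sub1set].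
  have K's : (#|K'| < s)%N.
    by apply: leq_trans (CSs CS); rewrite cardsU1 CS add1n ltnS.
  apply: ok => // l lC; apply: IHC; last exact: hits_setU1.
  by apply: card_clauseU1; rewrite /w; lia.
case: St S's IH => [C Cphi|C CS|C SC] S's IH.
- apply: (add C) => // K's dneg.
  have CK : (#|C| + #|K'| <= w)%N by have := phir _ Cphi; rewrite /w; lia.
  apply: (derivable_resolve_clause _ CK dneg).
  apply: (@derivable_subset _ _ _ C); last 2 first.
  + exact: subsetUl.
  + exact: leq_trans (leq_card_setU _ _) CK.
  by apply: derivable_axiom => //; have := phir _ Cphi; rewrite /w; lia.
- apply: IH; first by rewrite /w; lia.
  by move=> D /setD1P[_ /hK'].
- apply: (add C) => // K's dneg.
  apply: (@derivable_by_implication _ _ _ C) => //.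
  + by move=> D /phir; rewrite /w; lia.
  + by rewrite /w; lia.
  by move=> x /(hits_sat hK')/(inferring_sound SC).
Qed.

Lemma derivable_empty_of_space Ss :
  space_refutation phi Ss -> (refutation_space Ss <= s)%N -> derivable phi w set0.
Proof.
case=> Ss0 start steps final /bigmax_leqP_seq space.
have cS i : (i < size Ss)%N -> (#|nth set0 Ss i| <= s)%N.
  by move=> iS; apply: space => //; apply: mem_nth.
(* The index [j] counts back from the last configuration. *)
suff back j K : (j < size Ss)%N -> (#|K| <= w)%N ->
    hits K (nth set0 Ss ((size Ss).-1 - j)%N) -> derivable phi w K.
  apply: (back (size Ss).-1); rewrite ?cards0 ?subnn ?start //; first lia.
  by move=> C; rewrite inE.
elim: j K => [|j IH] K jS Kw.
  by rewrite subn0 nth_last => /(_ _ final)[l]; rewrite inE.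
have i1 : (((size Ss).-1 - j.+1).+1 = (size Ss).-1 - j)%N by lia.
apply: (@derivable_hits_step _ (nth set0 Ss ((size Ss).-1 - j)%N)) => //.
- by rewrite -i1; apply: steps; lia.
- by apply: cS; lia.
- by apply: cS; lia.
by move=> K0; apply: IH; lia.
Qed.

End Hitting.

Theorem theorem4p7 (n r : nat) (phi : cnf n) (phi_rcnf : linear_cnf r phi)
    (phi_unsat : unsatisfiable phi) :
  (min_width phi_unsat - r - 1 <= min_space phi_unsat)%N.
Proof.
rewrite /min_width /min_space.
case: ex_minnP => v _ vmin; case: ex_minnP => s /asboolP[Ss Ss_ref Ss_s] _.
(* The empty conjunction is satisfied by every assignment. *)
have phi_neq0 : phi != set0.
  apply: contraNneq phi_unsat => ->; apply/existsP; exists 0.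
  by apply/forallP => C; rewrite inE.
have [|pi pi_ref pi_w] := @refutation_of_derivable n phi (s + r + 1).
  by apply: derivable_empty_of_space Ss_ref _ => //; rewrite Ss_s.
have : (v <= refutation_width pi)%N by apply: vmin; apply/asboolP; exists pi.
lia.
Qed.
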